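(* Let $G$ be a group with neutral element $e$ and let $A=\bigoplus_{g\in G}A_g$ be a finite dimensional $G$-graded algebra over a field $k$. Then $A$ is graded Frobenius if and only if $A_e$ is a Frobenius algebra and $A$ is left $e$-faithful. Likewise, $A$ is graded Frobenius if and only if $A_e$ is a Frobenius algebra and $A$ is right $e$-faithful.
   Context: A finite dimensional $k$-algebra $R$ is Frobenius if $R\simeq R^*$ as left $R$-modules, where $R^*=\mathrm{Hom}_k(R,k)$ with $(af)(x)=f(xa)$. $A-gr$ denotes the category of $G$-graded left $A$-modules (with degree-preserving $A$-linear maps). The dual space $A^*$ is a graded left $A$-module with $(af)(x)=f(xa)$ and grading $(A^* )_g=\{f\in A^* \mid f(A_h)=0 \text{ for any } h\neq g^{-1}\}$. $A$ is called graded Frobenius if $A\simeq A^*$ in $A-gr$. $A$ is left $e$-faithful if $A_{g^{-1}}a_g\neq 0$ for any $g\in G$ and any non-zero $a_g\in A_g$. $A$ is right $e$-faithful if $a_gA_{g^{-1}}\neq 0$ for any $g\in G$ and any non-zero $a_g\in A_g$. *)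

(* Defs.v *)
From HB Require Import structures.
From mathcomp Require Import all_boot all_order all_fingroup all_algebra all_field.

Set Implicit Arguments.
Unset Strict Implicit.
Unset Printing Implicit Defensive.

Import GRing.Theory.
Local Open Scope ring_scope.

(* R^* = Hom_k(R, k), with the left R-module structure (a f)(x) = f(x a).     *)
(* It is an alias of 'Hom(R, k^o), so that its R-module structure does not    *)
(* collide with the k-vector space structure of the latter.                   *)
Definition dual (k : fieldType) (R : falgType k) : Type := 'Hom(R, k^o).

Section DualModule.
Variables (k : fieldType) (R : falgType k).

HB.instance Definition _ := GRing.Zmodule.copy (dual R) 'Hom(R, k^o).

Definition dual_eval (f : dual R) (x : R) : k := (f : 'Hom(R, k^o)) x.

(* amulr a is the map x |-> x * a *)
Definition dual_scale (a : R) (f : dual R) : dual R :=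
  ((f : 'Hom(R, k^o)) \o amulr a)%VF.

Lemma dual_scaleE a f x : dual_eval (dual_scale a f) x = dual_eval f (x * a).
Proof. by rewrite /dual_eval /dual_scale comp_lfunE lfunE. Qed.

Lemma dualP (f f' : dual R) : dual_eval f =1 dual_eval f' -> f = f'.
Proof. by move=> eq_f; apply/lfunP. Qed.

Lemma dual_evalD f f' x :
  dual_eval (f + f') x = dual_eval f x + dual_eval f' x.
Proof. exact: (@add_lfunE _ R k^o). Qed.

Lemma dual_eval_addr f x y :
  dual_eval f (x + y) = dual_eval f x + dual_eval f y.
Proof. by rewrite /dual_eval linearD. Qed.

Fact dual_scaleA a b f : dual_scale a (dual_scale b f) = dual_scale (a * b) f.
Proof. by apply: dualP => x; rewrite !dual_scaleE mulrA. Qed.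

Fact dual_scale1 : left_id 1 dual_scale.
Proof. by move=> f; apply: dualP => x; rewrite dual_scaleE mulr1. Qed.

Fact dual_scaleDr : right_distributive dual_scale +%R.
Proof.
by move=> a f f'; apply: dualP => x; rewrite dual_evalD !dual_scaleE dual_evalD.
Qed.

Fact dual_scaleDl f : {morph dual_scale^~ f : a b / a + b}.
Proof.
move=> a b; apply: dualP => x.
by rewrite dual_evalD !dual_scaleE mulrDr dual_eval_addr.
Qed.

HB.instance Definition _ := GRing.Zmodule_isLmodule.Build R (dual R)
  dual_scaleA dual_scale1 dual_scaleDr dual_scaleDl.

End DualModule.

Definition Frobenius (k : fieldType) (R : falgType k) : Prop :=
  exists phi : {linear R^o -> dual R}, bijective phi.

(* G may be infinite, hence the direct sum condition is stated on finite      *)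
(* subfamilies.                                                               *)
Record is_grading (G : groupType) (k : fieldType) (A : falgType k)
    (A_ : G -> {vspace A}) : Prop := IsGrading {
  grading_direct : forall s : seq G, uniq s -> directv (\sum_(g <- s) A_ g);
  grading_span : forall a : A, exists s : seq G, a \in (\sum_(g <- s) A_ g)%VS;
  grading_mul : forall g h : G, (A_ g * A_ h <= A_ (g * h)%g)%VS
}.

Record grading (G : groupType) (k : fieldType) (A : falgType k) := Grading {
  component :> G -> {vspace A};
  gradingP : is_grading component
}.

Section GradedAlgebra.
Variables (G : groupType) (k : fieldType) (A : falgType k) (A_ : grading G A).

Lemma grading_independent (s : seq G) (u : G -> A) :
    uniq s -> (forall g, g \in s -> u g \in A_ g) ->
    \sum_(g <- s) u g = 0 -> forall g, g \in s -> u g = 0.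
Proof.
move=> Us Au sum0 g sg.
have dxA : directv (\sum_(i < size s) A_ (tnth (in_tuple s) i)).
  by have := grading_direct (gradingP A_) Us; rewrite !directvE /= !(big_tnth _ _ s).
have := directv_sum_independent dxA (fun i => u (tnth (in_tuple s) i)).
rewrite -(big_tnth _ _ s xpredT u) => /(_ _ sum0) u0.
have [i ->] : exists i, g = tnth (in_tuple s) i by apply/tnthP.
by apply: u0 => // j _; apply: Au; rewrite (tnth_nth 1%g) mem_nth.
Qed.

Lemma sum_component_mem (s : seq G) (a : A) :
    a \in (\sum_(g <- s) A_ g)%VS ->
  exists2 u : G -> A, forall g, u g \in A_ g & a = \sum_(g <- undup s) u g.
Proof.
elim: s a => [|x s IHs] a /=.
  rewrite big_nil memv0 => /eqP->.
  by exists (fun=> 0) => [g|]; rewrite ?mem0v ?big_nil.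
rewrite big_cons => /memv_addP[b Ab [c /IHs[u Au ->] ->]].
pose w g := if g \in s then u g else 0.
have sum_w : \sum_(g <- undup s) w g = \sum_(g <- undup s) u g.
  by apply: eq_big_seq => g; rewrite mem_undup /w => ->.
exists (fun g => w g + (if g == x then b else 0)) => [g|].
  rewrite memvD // /w; first by case: ifP => _; rewrite ?mem0v.
  by case: eqP => [->|_]; rewrite ?mem0v.
case: ifPn => sx; last first.
  rewrite big_cons big_split /= sum_w {1}/w (negPf sx) eqxx add0r.
  rewrite [X in _ + (_ + X)]big1_seq ?addr0 // => g /andP[_].
  by rewrite mem_undup; case: eqP => // ->; rewrite (negPf sx).
rewrite big_split /= sum_w addrC; congr (_ + _).
rewrite (bigD1_seq x) ?mem_undup ?undup_uniq //= eqxx big1 ?addr0 // => g.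
by move/negPf->.
Qed.

Lemma component1_has_one : 1 \in A_ 1%g.
Proof.
have [s0 s0_1] := grading_span (gradingP A_) 1.
have: 1 \in (\sum_(g <- 1%g :: s0) A_ g)%VS.
  by rewrite big_cons -[1]add0r memv_add ?mem0v.
case/sum_component_mem=> u Au; set s := undup _ => def1.
have s1 : 1%g \in s by rewrite mem_undup mem_head.
suff mulu h b : b \in A_ h -> b * u 1%g = b.
  have <- : u 1%g = 1; last exact: Au.
  rewrite -[LHS]mul1r [X in X * _]def1 mulr_suml [RHS]def1.
  by apply: eq_bigr => g _; apply: mulu (Au g).
move=> Ab; pose v x := b * u (h^-1 * x)%g - (if x == h then b else 0).
have Us : uniq [seq (h * g)%g | g <- s].
  by rewrite map_inj_uniq ?undup_uniq //; apply: mulgI.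
have Av g : g \in [seq (h * g)%g | g <- s] -> v g \in A_ g.
  move=> _; rewrite memvB //; last by case: eqP => [->|_]; rewrite ?mem0v.
  rewrite -{2}[g](mulKVg h) (subvP (grading_mul (gradingP A_) _ _)) //.
  by rewrite memv_mul.
have sh : h \in [seq (h * g)%g | g <- s].
  by apply/mapP; exists 1%g; rewrite ?mulg1.
suff sum0 : \sum_(g <- [seq (h * g)%g | g <- s]) v g = 0.
  have := grading_independent Us Av sum0 sh.
  by rewrite /v mulVg eqxx => /subr0_eq.
rewrite sumrB [X in _ - X](bigD1_seq h) //= eqxx [X in _ - (_ + X)]big1 ?addr0; last first.
  by move=> g /negPf->.
rewrite big_map (eq_bigr (fun g => b * u g)) => [|g _]; last by rewrite mulKg.
by rewrite -mulr_sumr -def1 mulr1 subrr.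
Qed.

Lemma component1_is_aspace : is_aspace (A_ 1%g).
Proof.
rewrite /is_aspace (has_algid1 component1_has_one) /=.
by have := grading_mul (gradingP A_) 1%g 1%g; rewrite mulg1.
Qed.

(* The subalgebra A_e; its falgType structure is carried by subvs_of.         *)
Definition component1 : {aspace A} := ASpace component1_is_aspace.

(* A graded module is given by a left A-module together with its family of    *)
(* homogeneous components; an isomorphism of A-gr is a degree-preserving       *)
(* A-linear map with a degree-preserving A-linear inverse.                     *)
Definition gr_hom (V W : lmodType A) (V_ : G -> V -> Prop) (W_ : G -> W -> Prop)
    (f : {linear V -> W}) : Prop :=
  forall g v, V_ g v -> W_ g (f v).

Definition gr_isomorphic (V W : lmodType A)
    (V_ : G -> V -> Prop) (W_ : G -> W -> Prop) : Prop :=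
  exists (f : {linear V -> W}) (f' : {linear W -> V}),
    [/\ gr_hom V_ W_ f, gr_hom W_ V_ f', cancel f f' & cancel f' f].

Definition regular_component (g : G) (a : A^o) : Prop := a \in A_ g.

Definition dual_component (g : G) (f : dual A) : Prop :=
  forall h, h != (g^-1)%g -> forall x, x \in A_ h -> dual_eval f x = 0.

Definition graded_Frobenius : Prop :=
  gr_isomorphic regular_component dual_component.

Definition left_e_faithful : Prop :=
  forall g a, a \in A_ g -> a != 0 -> exists2 b, b \in A_ (g^-1)%g & b * a != 0.

Definition right_e_faithful : Prop :=
  forall g a, a \in A_ g -> a != 0 -> exists2 b, b \in A_ (g^-1)%g & a * b != 0.

End GradedAlgebra.

(* Main.v *)
From HB Require Import structures.
Require Import Defs.
From mathcomp Require Import all_boot all_order all_fingroup all_algebra all_field.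

Set Implicit Arguments.
Unset Strict Implicit.
Unset Printing Implicit Defensive.

Import GRing.Theory.
Local Open Scope ring_scope.

(** A left module map A -> A^* is determined by the image lam of 1: it sends a
    to the form x |-> lam (x * a).  Since A and A^* have the same dimension, it
    is bijective as soon as it is injective, so a Frobenius structure on A is a
    linear form lam such that lam (x * a) = 0 for all x only if a = 0
    ([Frobenius_form]).  The map is graded exactly when lam is homogeneous of
    degree e = 1%g, that is, when lam vanishes on A_h for all h <> e; hence A is
    graded Frobenius if and only if it has a nondegenerate form with this
    property ([graded_Frobenius_form]).

    Such a form only sees the degree e part of a product, so it is nondegenerate
    if and only if it pairs A_(g^-1) with A_g nondegenerately for every g.
    For g = e this says that its restriction to A_e is a Frobenius form; for the
    other g it shows that a nonzero a in A_g has b * a <> 0 for some b in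
    A_(g^-1), which is e-faithfulness.  Conversely, let lam be the extension by
    zero of a Frobenius form of A_e ([extend_form]).  If the component u_g of a is
    nonzero, then e-faithfulness moves it to a nonzero element b * u_g of A_e,
    and some c in A_e has lam (c * b * u_g) <> 0.  As c * b has degree g^-1, this
    scalar is lam (c * b * a), so lam is nondegenerate.

    The same argument with the factors exchanged gives the right-hand version,
    because nondegeneracy of a form on a finite dimensional algebra is
    left-right symmetric ([nondegenerate_sym]). *)

(** * Nondegenerate linear forms on an algebra *)

Section Nondegenerate.
Variables (k : fieldType) (V : vectType k).

Lemma dim_linear_forms : dim 'Hom(V, k^o) = dim V.
Proof. exact: muln1. Qed.

Lemma linear_forms_separate (v : V) : (forall f : 'Hom(V, k^o), f v = 0) -> v = 0.
Proof.
move=> v0; have vV : v \in <<vbasis (@fullv k V)>>%VS.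
  by rewrite (span_basis (vbasisP _)) memvf.
rewrite (coord_span vV) big1 // => i _.
have := v0 (linfun (coord (vbasis fullv) i : V -> k^o)).
by rewrite lfunE /= => ->; rewrite scale0r.
Qed.

(** Injectivity suffices because V and its dual have the same dimension. *)
Lemma injective_pairing_bijective (F : 'Hom(V, 'Hom(V, k^o))) :
  (forall v, F v = 0 -> v = 0) -> bijective F.
Proof.
move=> injF; have kerF : lker F == 0%VS.
  rewrite -subv0; apply/subvP=> v; rewrite memv_ker memv0 => /eqP/injF->.
  exact: eqxx.
have imF : limg F = fullv.
  apply/eqP; rewrite eqEdim subvf /= limg_dim_eq ?(eqP kerF) ?capv0 //.
  by rewrite !dimvf dim_linear_forms.
exists (F^-1)%VF; first exact: lker0_lfunK.
by move=> f; apply: limg_lfunVK; rewrite imF memvf.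
Qed.

(** If v |-> F v is injective then it reaches every linear form on V, and linear
    forms separate the points of V. *)
Lemma pairing_nondegenerate_sym (F : 'Hom(V, 'Hom(V, k^o))) :
    (forall v, (forall w, F v w = 0) -> v = 0) ->
  forall w, (forall v, F v w = 0) -> w = 0.
Proof.
move=> ndF; have [|F' _ F'K] := @injective_pairing_bijective F.
  by move=> v Fv0; apply: ndF => w; rewrite Fv0 lfunE.
by move=> w w0; apply: linear_forms_separate => f; rewrite -[f]F'K.
Qed.

End Nondegenerate.

Section FrobeniusForm.
Variables (k : fieldType) (R : falgType k).
Implicit Types (lam : dual R) (a x : R).

Definition left_nondegenerate lam :=
  forall a, (forall x, dual_eval lam (x * a) = 0) -> a = 0.

Definition right_nondegenerate lam :=
  forall a, (forall x, dual_eval lam (a * x) = 0) -> a = 0.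

Definition rmul_form lam a : 'Hom(R, k^o) := ((lam : 'Hom(R, k^o)) \o amulr a)%VF.
Definition lmul_form lam a : 'Hom(R, k^o) := ((lam : 'Hom(R, k^o)) \o amull a)%VF.

Fact rmul_form_is_linear lam : linear (rmul_form lam).
Proof. by move=> c a b; rewrite /rmul_form linearP comp_lfunDr comp_lfunZr. Qed.
HB.instance Definition _ lam := GRing.isLinear.Build k R 'Hom(R, k^o) _
  (rmul_form lam) (rmul_form_is_linear lam).

Fact lmul_form_is_linear lam : linear (lmul_form lam).
Proof. by move=> c a b; rewrite /lmul_form linearP comp_lfunDr comp_lfunZr. Qed.
HB.instance Definition _ lam := GRing.isLinear.Build k R 'Hom(R, k^o) _
  (lmul_form lam) (lmul_form_is_linear lam).

Definition left_pairing lam := linfun (rmul_form lam).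
Definition right_pairing lam := linfun (lmul_form lam).

Lemma left_pairingE lam a x : left_pairing lam a x = dual_eval lam (x * a).
Proof. by rewrite lfunE /= comp_lfunE lfunE. Qed.

Lemma right_pairingE lam a x : right_pairing lam a x = dual_eval lam (a * x).
Proof. by rewrite lfunE /= comp_lfunE lfunE. Qed.

Lemma nondegenerate_sym lam : left_nondegenerate lam <-> right_nondegenerate lam.
Proof.
split=> nd a a0.
- apply: (@pairing_nondegenerate_sym _ _ (left_pairing lam)) => [v v0|v].
    by apply: nd => x; rewrite -left_pairingE.
  by rewrite left_pairingE.
- apply: (@pairing_nondegenerate_sym _ _ (right_pairing lam)) => [v v0|v].
    by apply: nd => x; rewrite -right_pairingE.
  by rewrite right_pairingE.
Qed.

(** The same function as [rmul_form], as a map of left R-modules instead of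
    k-vector spaces. *)
Definition form_map lam (a : R^o) : dual R := (a : R) *: lam.

Lemma form_mapE lam (a : R) x : dual_eval (form_map lam a) x = dual_eval lam (x * a).
Proof. exact: dual_scaleE. Qed.

Fact form_map_is_linear lam : linear (form_map lam).
Proof. by move=> c a b; rewrite /form_map scalerDl scalerA. Qed.
HB.instance Definition _ lam := GRing.isLinear.Build R R^o (dual R) _ (form_map lam)
  (form_map_is_linear lam).

Lemma linear_form_mapE (f : {linear R^o -> dual R}) : f =1 form_map (f 1).
Proof. by move=> a; rewrite /form_map -linearZ /= -[in LHS](mulr1 a). Qed.

Lemma form_map_bij lam : left_nondegenerate lam -> bijective (form_map lam).
Proof.
move=> nd; have [|g gK Kg] := @injective_pairing_bijective _ _ (left_pairing lam).
  by move=> a a0; apply: nd => x; rewrite -left_pairingE a0 lfunE.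
have E a : form_map lam a = left_pairing lam a by rewrite lfunE.
by exists g => a; rewrite E.
Qed.

Lemma inj_form_map_nondegenerate lam :
  injective (form_map lam) -> left_nondegenerate lam.
Proof.
move=> inj a a0; apply: inj; apply: dualP => x.
by rewrite !form_mapE a0 mulr0 /dual_eval linear0.
Qed.

Lemma Frobenius_form : Frobenius R <-> exists lam, left_nondegenerate lam.
Proof.
split=> [[f bij_f]|[lam /form_map_bij bij]]; last by exists (form_map lam).
exists (f 1); apply: inj_form_map_nondegenerate => a b.
by rewrite -!linear_form_mapE; apply: (bij_inj bij_f).
Qed.

End FrobeniusForm.

(** * Homogeneous forms on a graded algebra *)

Lemma sum_single (T : eqType) (M : nmodType) (s : seq T) (F : T -> M) (i : T) :
    uniq s -> (forall j, j != i -> F j = 0) ->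
  \sum_(j <- s) F j = if i \in s then F i else 0.
Proof.
move=> Us F0; case: ifPn => si; first by rewrite (bigD1_seq i) //= big1 ?addr0.
by rewrite big1_seq // => j /andP[_ sj]; apply: F0; apply: contraNneq si => <-.
Qed.

Section Graded.
Variables (G : groupType) (k : fieldType) (A : falgType k) (A_ : grading G A).
Implicit Types (lam : dual A) (g h : G) (a b x : A).

(** Membership in the degree e component of the graded dual of A. *)
Definition homogeneous_form lam :=
  forall h, h != 1%g -> forall x, x \in A_ h -> dual_eval lam x = 0.

Lemma homogeneous_decomposition a : exists (s : seq G) (u : G -> A),
  [/\ uniq s, forall g, u g \in A_ g & a = \sum_(g <- s) u g].
Proof.
have [s /sum_component_mem[u Au ->]] := grading_span (gradingP A_) a.
by exists (undup s), u; rewrite undup_uniq.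
Qed.

Lemma mem_componentM g h a b :
  a \in A_ g -> b \in A_ h -> a * b \in A_ (g * h)%g.
Proof.
by move=> Aa Ab; apply: (subvP (grading_mul (gradingP A_) g h)); apply: memv_mul.
Qed.

Lemma form_sum lam (s : seq G) (u : G -> A) :
  dual_eval lam (\sum_(g <- s) u g) = \sum_(g <- s) dual_eval lam (u g).
Proof. by rewrite /dual_eval linear_sum. Qed.

(** Multiplication by an element of degree g^-1 moves only the component of degree
    g into degree e, the one degree where a homogeneous form may be nonzero. *)
Lemma homogeneous_formMl lam g b (s : seq G) (u : G -> A) :
    homogeneous_form lam -> uniq s -> (forall h, u h \in A_ h) ->
    b \in A_ (g^-1)%g ->
  dual_eval lam (b * \sum_(h <- s) u h) =
  if g \in s then dual_eval lam (b * u g) else 0.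
Proof.
move=> hom Us Au Ab; rewrite mulr_sumr form_sum.
apply: sum_single => // h ne_hg; apply: (hom (g^-1 * h)%g).
  by rewrite mulg_eq1 (inj_eq invg_inj) eq_sym.
exact: mem_componentM.
Qed.

Lemma homogeneous_formMr lam g b (s : seq G) (u : G -> A) :
    homogeneous_form lam -> uniq s -> (forall h, u h \in A_ h) ->
    b \in A_ (g^-1)%g ->
  dual_eval lam ((\sum_(h <- s) u h) * b) =
  if g \in s then dual_eval lam (u g * b) else 0.
Proof.
move=> hom Us Au Ab; rewrite mulr_suml form_sum.
apply: sum_single => // h ne_hg; apply: (hom (h * g^-1)%g).
  by rewrite mulg_eq1 invgK.
exact: mem_componentM.
Qed.

(** Nondegeneracy can be tested degree by degree: against a in A_g, only the
    component of degree g^-1 of the other factor contributes. *)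
Lemma left_nondegenerate_component lam g a :
    homogeneous_form lam -> left_nondegenerate lam -> a \in A_ g ->
    (forall b, b \in A_ (g^-1)%g -> dual_eval lam (b * a) = 0) -> a = 0.
Proof.
move=> hom nd Aa a0; apply: nd => x.
have [s [u [Us Au ->]]] := homogeneous_decomposition x.
have Aa' : a \in A_ (g^-1)^-1%g by rewrite invgK.
by rewrite (homogeneous_formMr hom Us Au Aa') a0 ?if_same.
Qed.

Lemma right_nondegenerate_component lam g a :
    homogeneous_form lam -> right_nondegenerate lam -> a \in A_ g ->
    (forall b, b \in A_ (g^-1)%g -> dual_eval lam (a * b) = 0) -> a = 0.
Proof.
move=> hom nd Aa a0; apply: nd => x.
have [s [u [Us Au ->]]] := homogeneous_decomposition x.
have Aa' : a \in A_ (g^-1)^-1%g by rewrite invgK.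
by rewrite (homogeneous_formMl hom Us Au Aa') a0 ?if_same.
Qed.

Lemma form_map_gr lam : homogeneous_form lam ->
  gr_hom (regular_component A_) (dual_component A_) (form_map lam).
Proof.
move=> hom g a Aa h ne_h x Ax; rewrite form_mapE; apply: (hom (h * g)%g).
  by rewrite mulg_eq1.
exact: mem_componentM.
Qed.

(** The inverse of a bijective [form_map] is degree-preserving too: if the image of
    a has degree g, then each component of a of another degree is orthogonal
    to the component of opposite degree, hence zero. *)
Lemma form_map_gr_reflect lam g a :
    homogeneous_form lam -> left_nondegenerate lam ->
    dual_component A_ g (form_map lam a) -> a \in A_ g.
Proof.
move=> hom nd; have [s [u [Us Au ->]]] := homogeneous_decomposition a => da.
rewrite big_seq; apply: memv_suml => h sh; have [<-//|ne_hg] := eqVneq h g.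
rewrite (left_nondegenerate_component hom nd (Au h)) ?mem0v // => b Ab.
have := homogeneous_formMl hom Us Au Ab; rewrite sh -form_mapE => <-.
by apply: da Ab; rewrite (inj_eq invg_inj).
Qed.

Lemma graded_Frobenius_form : graded_Frobenius A_ <->
  exists lam, homogeneous_form lam /\ left_nondegenerate lam.
Proof.
split=> [[f [f' [gr_f _ fK _]]]|[lam [hom nd]]].
  exists (f 1); split.
    (* f 1 is homogeneous of degree e because 1 is *)
    by have := gr_f _ _ (component1_has_one A_); rewrite /dual_component invg1.
  apply: inj_form_map_nondegenerate => a b.
  by rewrite -!linear_form_mapE; apply: (can_inj fK).
have [f' fK f'K] := form_map_bij nd.
pose F' := GRing.isLinear.Build A (dual A) A^o _ f' (can2_linear fK f'K).
pose L' : {linear dual A -> A^o} := HB.pack f' F'.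
exists (form_map lam), L'; split=> //; first exact: form_map_gr.
by move=> g phi dphi; apply: (form_map_gr_reflect hom nd); rewrite f'K.
Qed.

(** * Extending a form from the component of degree e *)

(** As A is finite dimensional, finitely many components span it, which makes the
    sum of the components of degree other than e available as a subspace. *)
Lemma grading_complement1 : exists t : seq G,
  [/\ uniq t, 1%g \notin t & fullv = (A_ 1%g + \sum_(g <- t) A_ g)%VS].
Proof.
have spanX (X : seq A) : exists r : seq G,
    forall a, a \in X -> a \in (\sum_(g <- r) A_ g)%VS.
  elim: X => [|a X [r rP]]; first by exists [::].
  have [t ta] := grading_span (gradingP A_) a.
  exists (t ++ r) => b; rewrite big_cat inE => /predU1P[->|/rP rb].
    exact: subvP (addvSl _ _) _ ta.
  exact: subvP (addvSr _ _) _ rb.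
have [r rP] := spanX (vbasis (@fullv k A)).
exists [seq g <- undup r | g != 1%g]; set t := filter _ _.
split; first by rewrite filter_uniq ?undup_uniq.
  by rewrite mem_filter eqxx.
apply/esym/eqP; rewrite eqEsubv subvf -(span_basis (vbasisP fullv)).
apply/span_subvP=> a /rP; apply: subvP; rewrite big_seq.
elim/big_ind: _ => [|U V sU sV|g rg]; first exact: sub0v.
  by rewrite subv_add sU.
have [->|ne_g1] := eqVneq g 1%g; first exact: addvSl.
apply: subv_trans (addvSr _ _).
by rewrite (big_rem g) ?addvSl // mem_filter ne_g1 mem_undup.
Qed.

Lemma dim_grading_sum (s : seq G) :
  uniq s -> \dim (\sum_(g <- s) A_ g) = \sum_(g <- s) \dim (A_ g).
Proof. by move/(grading_direct (gradingP A_)); rewrite directvE /= => /eqP. Qed.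

Lemma capv_component_sum h (s : seq G) :
  uniq s -> h \notin s -> (A_ h :&: \sum_(g <- s) A_ g = 0)%VS.
Proof.
move=> Us sh; have /dim_grading_sum : uniq (h :: s) by rewrite /= sh.
rewrite !big_cons -dim_grading_sum // => dimD.
apply/eqP; rewrite -dimv_eq0 -(eqn_add2l (\dim (A_ h + \sum_(g <- s) A_ g))).
by rewrite dimv_sum_cap dimD addn0.
Qed.

(** The extension is lam1 composed with the projection of A onto A_e along the
    other components. *)
Lemma extend_form (lam1 : dual (subvs_of (component1 A_))) :
  exists2 lam, homogeneous_form lam &
    forall x : subvs_of (component1 A_),
      dual_eval lam (vsval x) = dual_eval lam1 x.
Proof.
have [t [Ut t'1 fullE]] := grading_complement1.
pose V := (\sum_(g <- t) A_ g)%VS; pose E : {vspace A} := component1 A_.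
have dxEV : (E :&: V = 0)%VS by apply: capv_component_sum.
pose pr : 'Hom(A, subvs_of (component1 A_)) :=
  (linfun (vsproj (component1 A_)) \o daddv_pi E V)%VF.
exists ((lam1 : 'Hom(subvs_of (component1 A_), k^o)) \o pr)%VF => [h h1 x Ax|x];
  rewrite /dual_eval !comp_lfunE lfunE /=; last first.
  by rewrite daddv_pi_id ?subvsP // vsvalK.
suff Vx : x \in V.
  have : daddv_pi E V x = 0.
    have := daddv_pi_add dxEV (subvP (addvSr E V) _ Vx).
    rewrite capvC in dxEV.
    by rewrite (daddv_pi_id dxEV Vx) => /(canRL (addrK x)); rewrite subrr.
  by move=> ->; rewrite !linear0.
have [th|t'h] := boolP (h \in t).
  by apply: subvP Ax; rewrite /V (big_rem h) ?addvSl.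
(* the degrees in e :: t already span A, so A_h is zero for all other h *)
suff: x \in 0%VS by rewrite memv0 => /eqP->; apply: mem0v.
rewrite -(@capv_component_sum h (1%g :: t)) ?big_cons; last first.
- by rewrite inE negb_or h1.
- by rewrite /= t'1.
by rewrite -fullE capvf.
Qed.

(** * The Frobenius property in degree e, and e-faithfulness *)

Lemma Frobenius_component1 lam : homogeneous_form lam ->
  left_nondegenerate lam -> Frobenius (subvs_of (component1 A_)).
Proof.
move=> hom nd; apply/Frobenius_form.
pose lam1 : dual (subvs_of (component1 A_)) :=
  ((lam : 'Hom(A, k^o)) \o linfun vsval)%VF.
have lam1E (x : subvs_of _) : dual_eval lam1 x = dual_eval lam (vsval x).
  by rewrite /dual_eval comp_lfunE lfunE.
exists lam1 => a a0; apply: val_inj => /=.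
apply: (left_nondegenerate_component hom nd (subvsP a)) => b.
by rewrite invg1 => Ab; have := a0 (Subvs Ab); rewrite lam1E.
Qed.

(** A nonzero a in A_g is not orthogonal to A_(g^-1), so A_(g^-1) cannot annihilate
    it.  Phrasing annihilation as inclusion in a kernel makes it decidable, which
    yields the witness. *)
Lemma left_e_faithful_form lam : homogeneous_form lam ->
  left_nondegenerate lam -> left_e_faithful A_.
Proof.
move=> hom nd g a Aa nz_a.
have /subvPn[b Ab] : ~~ (A_ (g^-1)%g <= lker (amulr a))%VS.
  apply: contraNN nz_a => /subvP ker_a; apply/eqP.
  apply: (left_nondegenerate_component hom nd Aa) => b /ker_a.
  by rewrite memv_ker lfunE /= => /eqP->; rewrite /dual_eval linear0.
by rewrite memv_ker lfunE /=; exists b.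
Qed.

Lemma right_e_faithful_form lam : homogeneous_form lam ->
  right_nondegenerate lam -> right_e_faithful A_.
Proof.
move=> hom nd g a Aa nz_a.
have /subvPn[b Ab] : ~~ (A_ (g^-1)%g <= lker (amull a))%VS.
  apply: contraNN nz_a => /subvP ker_a; apply/eqP.
  apply: (right_nondegenerate_component hom nd Aa) => b /ker_a.
  by rewrite memv_ker lfunE /= => /eqP->; rewrite /dual_eval linear0.
by rewrite memv_ker lfunE /=; exists b.
Qed.

Section Extension.
Variables (lam : dual A) (lam1 : dual (subvs_of (component1 A_))).
Hypotheses (hom : homogeneous_form lam)
  (lamE : forall x : subvs_of (component1 A_),
     dual_eval lam (vsval x) = dual_eval lam1 x).

(** A nonzero component u g of a is first moved by some b to a nonzero element of
    A_e, which some c in A_e then detects. *)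
Lemma left_nondegenerate_extend :
  left_nondegenerate lam1 -> left_e_faithful A_ -> left_nondegenerate lam.
Proof.
move=> nd faith a a0; have [s [u [Us Au def_a]]] := homogeneous_decomposition a.
rewrite def_a big1_seq // => g /andP[_ sg].
apply/eqP/negPn/negP => /(faith _ _ (Au g))[b Ab /negP[]].
have A1 : b * u g \in component1 A_.
  by have := mem_componentM Ab (Au g); rewrite mulVg.
suff /(congr1 vsval)/= -> : Subvs A1 = 0 by [].
apply: nd => c; rewrite -lamE /= mulrA.
have Acb : vsval c * b \in A_ (g^-1)%g.
  by have := mem_componentM (subvsP c) Ab; rewrite mul1g.
by have := homogeneous_formMl hom Us Au Acb; rewrite sg -def_a a0.
Qed.

Lemma right_nondegenerate_extend :
  right_nondegenerate lam1 -> right_e_faithful A_ -> right_nondegenerate lam.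
Proof.
move=> nd faith a a0; have [s [u [Us Au def_a]]] := homogeneous_decomposition a.
rewrite def_a big1_seq // => g /andP[_ sg].
apply/eqP/negPn/negP => /(faith _ _ (Au g))[b Ab /negP[]].
have A1 : u g * b \in component1 A_.
  by have := mem_componentM (Au g) Ab; rewrite mulgV.
suff /(congr1 vsval)/= -> : Subvs A1 = 0 by [].
apply: nd => c; rewrite -lamE /= -mulrA.
have Abc : b * vsval c \in A_ (g^-1)%g.
  by have := mem_componentM Ab (subvsP c); rewrite mulg1.
by have := homogeneous_formMr hom Us Au Abc; rewrite sg -def_a a0.
Qed.

End Extension.

End Graded.

Theorem corollary4p4 (G : groupType) (k : fieldType) (A : falgType k)
    (A_ : grading G A) :
  (graded_Frobenius A_ <->
     Frobenius (subvs_of (component1 A_)) /\ left_e_faithful A_) /\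
  (graded_Frobenius A_ <->
     Frobenius (subvs_of (component1 A_)) /\ right_e_faithful A_).
Proof.
split; split=> [/graded_Frobenius_form[lam [hom nd]]|[Frob1 faith]].
- split; first exact: Frobenius_component1 hom nd.
  exact: left_e_faithful_form hom nd.
- have [lam1 nd1] := (Frobenius_form _).1 Frob1.
  have [lam hom lamE] := extend_form lam1; apply/graded_Frobenius_form.
  by exists lam; split=> //; apply: left_nondegenerate_extend lamE _ _.
- split; first exact: Frobenius_component1 hom nd.
  exact: right_e_faithful_form hom ((nondegenerate_sym lam).1 nd).
- have [lam1 /nondegenerate_sym nd1] := (Frobenius_form _).1 Frob1.
  have [lam hom lamE] := extend_form lam1; apply/graded_Frobenius_form.
  exists lam; split=> //; apply/nondegenerate_sym.
  exact: right_nondegenerate_extend lamE _ _.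
Qed.
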